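(* Let $k, n, N$ be natural numbers with $2 \le k \le n$ and $N \ge 1$. Let $\pi^k_n$ denote the probability that all elements in a sample of $k$ independent, uniformly random elements (with repetition allowed) from a set of size $n$ are distinct, i.e. $\pi^k_n = \prod_{i=1}^{k-1}\left(1-\frac{i}{n}\right)$. For each natural number $m \ge 1$ let $\mathfrak{p}(k-1,m) = \sum_{i=1}^{k-1} i^m$, and define $$\epsilon^k_n(N) := \frac{\left(k-\frac12\right)^{N+1}}{N(N+1)\left(1-\frac{k-\frac12}{n}\right)n^N}.$$ Then $$\sum_{m=1}^{N-1} \frac{\mathfrak{p}(k-1,m)}{m\,n^m} \;<\; -\ln(\pi^k_n) \;<\; \sum_{m=1}^{N-1} \frac{\mathfrak{p}(k-1,m)}{m\,n^m} + \epsilon^k_n(N).$$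
   Context: $\ln$ is the natural logarithm. For $N=1$ the sum $\sum_{m=1}^{N-1}$ is empty and equals $0$. *)

(* Defs.v *)
From mathcomp Require Import all_boot all_order all_algebra.
From mathcomp Require Import reals exp.

Set Implicit Arguments.
Unset Strict Implicit.
Unset Printing Implicit Defensive.

Import Order.TTheory GRing.Theory Num.Theory.
Local Open Scope ring_scope.

(* k independent uniform draws from an n-element set form a uniformly
   distributed k-tuple over 'I_n, so the probability that the draws are
   distinct is the proportion of duplicate-free k-tuples. *)
Definition prob_distinct (R : realType) (k n : nat) : R :=
  #|[set t : k.-tuple 'I_n | uniq t]|%:R / #|{: k.-tuple 'I_n}|%:R.

Lemma prob_distinctE (R : realType) (k n : nat) : (0 < n)%N ->
  prob_distinct R k n = \prod_(1 <= i < k) (1 - i%:R / n%:R).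
Proof.
move=> n_gt0; have n_neq0 : n%:R != 0 :> R by rewrite pnatr_eq0 -lt0n.
have -> : prob_distinct R k n = (n ^_ k)%:R / (n ^ k)%:R.
  rewrite /prob_distinct card_tuple card_ord; congr (_%:R / _).
  rewrite -[in RHS](card_ord n) -card_uniq_tuples.
  by apply: eq_card => t; rewrite !inE; case: allP => // -[].
transitivity (\prod_(0 <= i < k) (1 - i%:R / n%:R) : R); last first.
  case: k => [|k]; first by rewrite !big_geq.
  by rewrite big_ltn // mul0r subr0 mul1r.
elim: k => [|k IHk]; first by rewrite big_geq // ffactn0 expn0 divr1.
rewrite big_nat_recr //= -IHk ffactnSr expnSr !natrM.
have [le_kn | lt_nk] := leqP k n; last by rewrite ffact_small // !mul0r.
rewrite natrB // invfM mulrACA; congr (_ * _).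
by rewrite mulrBl divff.
Qed.

Definition power_sum (K m : nat) : nat := (\sum_(1 <= i < K.+1) i ^ m)%N.

Definition birthday_eps (R : realType) (k n N : nat) : R :=
  (k%:R - 2^-1) ^+ N.+1 /
  (N%:R * N.+1%:R * (1 - (k%:R - 2^-1) / n%:R) * n%:R ^+ N).

(* Main.v *)
Require Import Defs.
From mathcomp Require Import all_boot all_order all_algebra.
From mathcomp Require Import reals exp.
From mathcomp Require Import normedtype derive realfun ring lra.

(* Each -ln(1 - i/n) exceeds its Taylor polynomial, and the tails sum to the
   p(k-1,m) / (m n^m) for m >= N. Midpoint convexity of y^m gives
   p(k-1,m) <= (k-1/2)^(m+1) / (m+1), so these tails are dominated by a geometric
   series of ratio r = (k-1/2)/n and total epsilon. Cutting the expansion at order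
   N + d replaces the series by a partial sum, at most epsilon (1 - r^d), plus a
   Taylor remainder at most r^d n^2 / (N + d), which is below epsilon r^d as soon as
   d is large; this also makes the upper bound strict. *)

Set Implicit Arguments.
Unset Strict Implicit.

Import Order.TTheory GRing.Theory Num.Theory.
Import numFieldNormedType.Exports.
Local Open Scope ring_scope.

(** This is the mean value theorem for [- ln (1 - z) - p.[z]] on [[0, x]], a function that vanishes
    at 0. *)
Lemma ln1B_poly_MVT (R : realType) (p : {poly R}) (x : R) :
    0 < x < 1 -> p.[0] = 0 ->
  exists2 y, 0 < y < x &
    - ln (1 - x) = p.[x] + ((1 - y)^-1 - p^`().[y]) * x.
Proof.
move=> /andP[x_gt0 x_lt1] p0.
pose f (z : R) := - ln (1 - z) - p.[z].
have der (y : R) : y < 1 -> is_derive y 1 f ((1 - y)^-1 - p^`().[y]).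
  move=> y_lt1.
  have d1 : is_derive (1 - y) 1 (@ln R) (1 - y)^-1.
    by apply: is_derive1_ln; rewrite subr_gt0.
  have d2 : is_derive y 1 (fun z : R => 1 - z) (-1).
    have := is_deriveB (is_derive_cst (1 : R^o) (y : R^o) 1) (is_derive_id y 1).
    by move/is_derive_eq; apply; rewrite sub0r.
  have d3 := @is_derive1_comp _ (@ln R) (fun z => 1 - z) y _ _ d1 d2.
  have d4 := is_deriveN d3.
  have d5 := is_deriveB d4 (is_derive_poly p y).
  apply: (is_derive_eq d5).
  by rewrite mulrN1 opprK.
have f0 : f 0 = 0 by rewrite /f p0 (_ : 1 - 0 = 1) ?ln1 ?oppr0 ?addr0.
have [y yx fx] : exists2 y, y \in `]0, x[
    & f x - f 0 = ((1 - y)^-1 - p^`().[y]) * (x - 0).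
  apply: MVT => // [y|].
    by rewrite in_itv /= => /andP[_ yx]; apply/der/(lt_trans yx).
  apply: derivable_within_continuous => y; rewrite in_itv /= => /andP[_ yx].
  by have [] := der y (le_lt_trans yx x_lt1).
move: fx; rewrite f0 !subr0 => eq_y.
exists y; first by move: yx; rewrite in_itv.
by rewrite -eq_y /f [RHS]addrC subrK.
Qed.

(* The free coefficient c of the last monomial is set to 1 for the lower bound and
   to (1 - x)^-1 for the upper bound, which fixes the sign of the last term. *)
Lemma ln1B_expansion (R : realType) (x c : R) (M : nat) : 0 < x < 1 ->
  exists2 y, 0 < y < x &
    - ln (1 - x) = \sum_(1 <= m < M.+1) x ^+ m / m%:R
      + c * x ^+ M.+1 / M.+1%:R + y ^+ M * ((1 - y)^-1 - c) * x.
Proof.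
move=> x01; have /andP[_ x_lt1] := x01.
pose p : {poly R} := \sum_(1 <= m < M.+1) m%:R^-1 *: 'X^m
  + (c / M.+1%:R) *: 'X^(M.+1).
have pE z : p.[z] = \sum_(1 <= m < M.+1) z ^+ m / m%:R
    + c * z ^+ M.+1 / M.+1%:R.
  rewrite /p hornerD horner_sum hornerZ hornerXn mulrAC; congr (_ + _).
  by apply: eq_bigr => m _; rewrite hornerZ hornerXn mulrC.
have dpE z : p^`().[z] = \sum_(i < M) z ^+ i + c * z ^+ M.
  rewrite /p derivD raddf_sum /= hornerD horner_sum big_add1 big_mkord.
  congr (_ + _); last first.
    rewrite derivZ derivXn hornerZ hornerMn hornerXn -(mulr_natr (z ^+ M)).
    by rewrite mulrACA mulVf ?mulr1 // pnatr_eq0.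
  apply: eq_bigr => i _; rewrite derivZ derivXn hornerZ hornerMn hornerXn /=.
  by rewrite -(mulr_natr (z ^+ i)) mulrCA mulVf ?mulr1 // pnatr_eq0.
have p0 : p.[0] = 0.
  rewrite pE expr0n /= mulr0 mul0r addr0 big_nat big1 // => m /andP[m_gt0 _].
  by rewrite expr0n gtn_eqF ?mul0r.
have [y yx ->] := ln1B_poly_MVT x01 p0.
exists y => //; rewrite pE dpE; congr (_ + _ * _).
have y_neq1 : 1 - y != 0.
  by have /andP[_ /lt_trans/(_ x_lt1)] := yx; rewrite -subr_gt0; exact: lt0r_neq0.
have := subrX1 y M; set S := \sum_(i < M) _ => eqS.
have -> : S = (1 - y ^+ M) / (1 - y).
  apply: (mulIf y_neq1); rewrite mulfVK // -[LHS]opprK -mulrN opprB mulrC -eqS.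
  by rewrite opprB.
by field.
Qed.

Lemma ln1B_gt_sum (R : realType) (N : nat) (x : R) : 0 < x < 1 ->
  \sum_(1 <= m < N.+1) x ^+ m / m%:R < - ln (1 - x).
Proof.
move=> x01; have [y /andP[y_gt0 y_ltx] ->] := ln1B_expansion 1 N x01.
have /andP[x_gt0 x_lt1] := x01; rewrite -addrA ltrDl mul1r ltr_wpDr //.
- rewrite !mulr_ge0 ?exprn_ge0 ?(ltW y_gt0) ?(ltW x_gt0) // subr_ge0.
  by rewrite invr_ge1 ?unitfE ?subr_gt0 ?gt_eqF ?subr_gt0 ?gerBl; lra.
- by rewrite divr_gt0 ?exprn_gt0 ?ltr0n.
Qed.

Lemma ln1B_le_sum (R : realType) (N : nat) (x : R) : 0 < x < 1 ->
  - ln (1 - x) <=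
    \sum_(1 <= m < N.+1) x ^+ m / m%:R + x ^+ N.+1 / (N.+1%:R * (1 - x)).
Proof.
move=> x01; have [y /andP[y_gt0 y_ltx] ->] := ln1B_expansion (1 - x)^-1 N x01.
have /andP[x_gt0 x_lt1] := x01.
have -> : x ^+ N.+1 / (N.+1%:R * (1 - x)) = (1 - x)^-1 * x ^+ N.+1 / N.+1%:R.
  by rewrite invfM; ring.
rewrite gerDl mulr_le0_ge0 ?(ltW x_gt0) //.
rewrite mulr_ge0_le0 ?exprn_ge0 ?(ltW y_gt0) // subr_le0 lef_pV2 ?posrE; lra.
Qed.

(** The right side is [m.+1] times the integral of [t ^+ m] over the unit interval centred at [y],
    which is at least the value at the midpoint. *)
Lemma midpoint_power_le (R : realFieldType) (m : nat) (y : R) : 0 <= y ->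
  m.+1%:R * y ^+ m <= (y + 2^-1) ^+ m.+1 - (y - 2^-1) ^+ m.+1.
Proof.
move=> y_ge0.
suff [] : m.+1%:R * y ^+ m <= (y + 2^-1) ^+ m.+1 - (y - 2^-1) ^+ m.+1
    /\ 2 * y ^+ m.+1 <= (y + 2^-1) ^+ m.+1 + (y - 2^-1) ^+ m.+1 by [].
(* The lower bound on the sum of the two powers is what makes the induction go
   through: with u_m, v_m the sum and difference of the m-th powers,
   v_(m+1) = y v_m + u_m / 2 and u_(m+1) = y u_m + v_m / 2. *)
elim: m => [|m [IHd IHs]]; first by rewrite !expr1; split; lra.
rewrite ![_ ^+ m.+2]exprS -(natr1 m.+1).
move: IHd IHs; rewrite [y ^+ m.+1]exprS.
have : 0 <= y ^+ m by rewrite exprn_ge0.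
have : 0 <= m.+1%:R :> R by rewrite ler0n.
move: (m.+1%:R) (y ^+ m) (_ ^+ m.+1) (_ ^+ m.+1) => M P U V M_ge0 P_ge0 IHd IHs.
have dy := ler_wpM2l y_ge0 IHd; have sy := ler_wpM2l y_ge0 IHs.
have MP := mulr_ge0 M_ge0 P_ge0.
split; nra.
Qed.

(** The midpoint bounds at the integers 1 to [K] telescope; the leftover [2^-1 ^+ m.+1] at the lower
    end is dropped. *)
Lemma power_sum_le (R : realFieldType) (K m : nat) :
  m.+1%:R * (power_sum K m)%:R <= (K%:R + 2^-1) ^+ m.+1 :> R.
Proof.
elim: K => [|K IHK].
  by rewrite /power_sum big_geq // mulr0 add0r exprn_ge0 // invr_ge0.
have -> : power_sum K.+1 m = (power_sum K m + K.+1 ^ m)%N.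
  by rewrite /power_sum big_nat_recr.
have := midpoint_power_le m (ler0n R K.+1).
rewrite natrD natrX mulrDr -[K.+1%:R in X in _ <= _ - X]natr1.
have -> : K%:R + 1 - 2^-1 = K%:R + 2^-1 :> R by lra.
lra.
Qed.

(** Exchanging the sums lets the bounds on [- ln (1 - x)] be applied factor by factor, at
    [x = i / n]. *)
Lemma power_sum_series (R : realType) (k n N : nat) :
  \sum_(1 <= m < N) (power_sum k.-1 m)%:R / (m%:R * n%:R ^+ m) =
  \sum_(1 <= i < k) \sum_(1 <= m < N) (i%:R / n%:R) ^+ m / m%:R :> R.
Proof.
rewrite exchange_big /=; apply: eq_bigr => m _; rewrite /power_sum.
case: k => [|k]; first by rewrite !big_geq // mul0r.
rewrite /= natr_sum big_distrl /=; apply: eq_bigr => i _.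
by rewrite natrX expr_div_n invfM mulrA mulrAC.
Qed.

Lemma birthday_tail_le (R : realType) (k n N d : nat) :
    (0 < k <= n)%N -> (0 < N)%N ->
  \sum_(N <= m < N + d) (power_sum k.-1 m)%:R / (m%:R * n%:R ^+ m)
    <= birthday_eps R k n N * (1 - ((k%:R - 2^-1) / n%:R) ^+ d).
Proof.
move=> /andP[k_gt0 le_kn] N_gt0.
have nN_gt0 : (0 < n)%N by apply: leq_trans le_kn.
have n_gt0 : 0 < n%:R :> R by rewrite ltr0n.
set a := k%:R - 2^-1; set r := a / n%:R.
have k_ge1 : 1 <= k%:R :> R by rewrite ler1n.
have a_gt0 : 0 < a by rewrite /a; lra.
have r_gt0 : 0 < r by rewrite divr_gt0.
have r_lt1 : r < 1.
  by rewrite ltr_pdivrMr // mul1r /a; move: le_kn; rewrite -(ler_nat R); lra.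
elim: d => [|d IHd]; first by rewrite addn0 big_geq // subrr mulr0.
rewrite addnS big_nat_recr ?leq_addr //=.
(* [C] bounds the first tail term, and [C / (1 - r)], the full geometric series, is epsilon. *)
pose C := a ^+ N.+1 / (N%:R * N.+1%:R * n%:R ^+ N).
have epsE : birthday_eps R k n N * (1 - r) = C.
  rewrite /birthday_eps -/a -/r /C; field.
  by rewrite nat1r !pnatr_eq0 expf_neq0 -?lt0n ?N_gt0 //= ?gt_eqF // subr_gt0.
suff : (power_sum k.-1 (N + d))%:R / ((N + d)%:R * n%:R ^+ (N + d)) <= C * r ^+ d.
  by rewrite -epsE exprS; move: IHd; lra.
have pS : (N + d).+1%:R * (power_sum k.-1 (N + d))%:R <= a ^+ (N + d).+1.
  have -> : a = k.-1%:R + 2^-1 by rewrite /a -[in LHS](prednK k_gt0) -natr1; lra.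
  exact: power_sum_le.
have M_gt0 : 0 < (N + d)%:R :> R by rewrite ltr0n addn_gt0 N_gt0.
(* With [M = N + d], the factor [M * M.+1] in the denominator is then lowered to [N * N.+1], which
   leaves exactly [C * r ^+ d]. *)
apply: (@le_trans _ _
  (a ^+ (N + d).+1 / ((N + d)%:R * (N + d).+1%:R * n%:R ^+ (N + d)))).
  rewrite ler_pdivrMr ?mulr_gt0 ?exprn_gt0 //.
  rewrite -[leRHS]mulrA (_ : _^-1 * _ = (N + d).+1%:R^-1).
    by rewrite ler_pdivlMr ?ltr0n // mulrC.
  rewrite [_ * _.+1%:R]mulrC -mulrA invfM mulfVK //.
  by rewrite gt_eqF // mulr_gt0 ?exprn_gt0.
rewrite (_ : C * _ = a ^+ (N + d).+1 / (N%:R * N.+1%:R * n%:R ^+ (N + d))).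
  rewrite ler_wpM2l ?exprn_ge0 ?(ltW a_gt0) // lef_pV2 ?posrE;
    rewrite ?mulr_gt0 ?exprn_gt0 ?ltr0n ?addn_gt0 ?N_gt0 //.
  by rewrite ler_pM2r ?exprn_gt0 // -!natrM ler_nat leq_mul ?ltnS ?leq_addr.
by rewrite /C /r expr_div_n mulf_div -exprD -(mulrA (N%:R * _)) -exprD addSn.
Qed.

Theorem theorem2 (R : realType) (k n N : nat)
    (k_ge2 : (2 <= k)%N) (k_le_n : (k <= n)%N) (N_ge1 : (1 <= N)%N) :
  \sum_(1 <= m < N) (power_sum k.-1 m)%:R / (m%:R * n%:R ^+ m)
    < - ln (prob_distinct R k n)
  /\
  - ln (prob_distinct R k n)
    < \sum_(1 <= m < N) (power_sum k.-1 m)%:R / (m%:R * n%:R ^+ m)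
      + birthday_eps R k n N.
Proof.
have k_gt0 : (0 < k)%N by apply: ltn_trans k_ge2.
have n_gt0 : (0 < n)%N by apply: leq_trans k_le_n.
have nR_gt0 : 0 < n%:R :> R by rewrite ltr0n.
have x01 i : (1 <= i < k)%N -> 0 < (i%:R / n%:R : R) < 1.
  move=> /andP[i_gt0 i_ltk]; rewrite divr_gt0 ?ltr0n //=.
  by rewrite ltr_pdivrMr // mul1r ltr_nat (leq_trans i_ltk).
have lnE : - ln (prob_distinct R k n) =
    \sum_(1 <= i < k) - ln (1 - i%:R / n%:R).
  rewrite prob_distinctE // sumrN; congr (- _).
  (* Positivity is carried along because [lnM] needs positive factors. *)
  pose K (p s : R) := 0 < p /\ ln p = s.
  suff [] : K (\prod_(1 <= i < k) (1 - i%:R / n%:R))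
              (\sum_(1 <= i < k) ln (1 - i%:R / n%:R)) by [].
  rewrite !big_nat; apply: (big_rec2 K); first by rewrite /K ln1.
  move=> i p s i_int [p_gt0 <-]; have /andP[_ i_lt1] := x01 i i_int.
  by rewrite /K lnM ?posrE ?mulr_gt0 ?subr_gt0.
case: N N_ge1 => // N _; split.
  (* Strictness survives summation because [k >= 2] makes the range of [i] nonempty. *)
  rewrite lnE power_sum_series; apply: ltr_sum_nat => // i /x01.
  exact: ln1B_gt_sum.
set E := birthday_eps R k n N.+1.
set a : R := k%:R - 2^-1; set r := a / n%:R.
have k_ge1 : 1 <= k%:R :> R by rewrite ler1n.
have a_gt0 : 0 < a by rewrite /a; lra.
have r_gt0 : 0 < r by rewrite divr_gt0.
have a_ltn : a < n%:R by move: k_le_n; rewrite /a -(ler_nat R); lra.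
have r_lt1 : r < 1 by rewrite ltr_pdivrMr // mul1r.
have E_gt0 : 0 < E.
  rewrite /E /birthday_eps -/a -/r divr_gt0 ?exprn_gt0 //.
  by rewrite mulr_gt0 ?exprn_gt0 // mulr_gt0 ?subr_gt0 // mulr_gt0 ?ltr0n.
(* This order is high enough that [n ^ 2 / (N.+1 + d)] falls below [E]. *)
pose d := Num.truncn (n%:R ^+ 2 / E : R).
have d_gt : n%:R ^+ 2 < E * (N.+1 + d)%:R.
  rewrite mulrC -ltr_pdivrMr //; apply: lt_le_trans (truncnS_gt _) _.
  by rewrite ler_nat -/d addSn ltnS leq_addl.
pose x i : R := i%:R / n%:R.
(* Each [x i] is at most [r] and below 1, so its power is at most [r ^+ d]; [i < k <= n] gives
   [(1 - x i)^-1 <= n]; and there are at most [n] terms. *)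
have tail_le : \sum_(1 <= i < k) x i ^+ (N.+1 + d) / ((N.+1 + d)%:R * (1 - x i))
    <= r ^+ d * n%:R ^+ 2 / (N.+1 + d)%:R.
  apply: (@le_trans _ _
    (\sum_(1 <= i < k) r ^+ d * n%:R / (N.+1 + d)%:R)); last first.
    rewrite sumr_const_nat -[leLHS]mulr_natr mulrAC.
    rewrite ler_pM2r ?invr_gt0 ?ltr0n // expr2 [leRHS]mulrA.
    rewrite ler_pM2l ?(mulr_gt0 (exprn_gt0 _ r_gt0)) //.
    by rewrite ler_nat (leq_trans _ k_le_n) ?leq_subr.
  apply: ler_sum_nat => i i_int; have /andP[xi_gt0 xi_lt1] := x01 i i_int.
  have /andP[_ i_ltk] := i_int.
  have xi_ler : x i <= r.
    rewrite /x /r ler_pM2r ?invr_gt0 // /a.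
    by move: i_ltk; rewrite -(ler_nat R) -natr1; lra.
  rewrite invfM mulrA mulrAC ler_pM2r ?invr_gt0 ?ltr0n //.
  apply: ler_pM; rewrite ?exprn_ge0 ?invr_ge0 ?subr_ge0 //;
    rewrite ?(ltW xi_gt0) ?(ltW xi_lt1) //.
    rewrite exprD -[leRHS]mul1r ler_pM ?exprn_ge0 ?exprn_ile1 ?lerXn2r ?nnegrE;
    by rewrite ?(ltW xi_gt0) ?(ltW xi_lt1) ?(ltW r_gt0).
  rewrite -[leRHS]invrK lef_pV2 ?posrE ?invr_gt0 ?subr_gt0 //.
  rewrite lerBrDl (_ : x i + n%:R^-1 = i.+1%:R / n%:R).
    by rewrite ler_pdivrMr // mul1r ler_nat (leq_trans i_ltk).
  by rewrite -natr1 mulrDl mul1r.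
have upper : - ln (prob_distinct R k n) <=
    \sum_(1 <= m < N.+1 + d) (power_sum k.-1 m)%:R / (m%:R * n%:R ^+ m)
    + r ^+ d * n%:R ^+ 2 / (N.+1 + d)%:R.
  rewrite lnE power_sum_series; apply: le_trans (lerD (lexx _) tail_le).
  rewrite -big_split; apply: ler_sum_nat => i /x01; rewrite addSn.
  exact: ln1B_le_sum.
(* Past the main sum, the middle block is at most [E * (1 - r ^+ d)] and the remainder is strictly
   below [r ^+ d * E]; together they stay below [E]. *)
apply: le_lt_trans upper _; rewrite (big_cat_nat (n := N.+1)) ?leq_addr //=.
have le_tail := @birthday_tail_le R k n N.+1 d _ (ltn0Sn N).
rewrite k_gt0 k_le_n -/E -/a -/r in le_tail; move: le_tail => /(_ isT) le_tail.
have : r ^+ d * n%:R ^+ 2 / (N.+1 + d)%:R < r ^+ d * E.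
  by rewrite -mulrA ltr_pM2l ?exprn_gt0 // ltr_pdivrMr ?ltr0n.
by move: le_tail; lra.
Qed.
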